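(* Let $\mu$ be the natural Cantor probability measure on the middle-third Cantor set, $\gamma=\frac{\log2}{\log3}$ and $\beta=1-\gamma$. There is an absolute constant $A_0>0$ such that the following holds. Let $H\ge 3$ be an integer and let $K$ be the integer with $3^K\le H<3^{K+1}$. Then for every integer $M\ge0$ and every nonzero integer $q$, \[ \sum_{M<n\le M+H}|\widehat\mu(q2^n)|\le A_0\, H^\gamma\, 3^{\beta\min(\nu_3(q),K)}, \] where the sum is over integers $n$.
   Context: The measure $\mu$ is the law of $\sum_{k\ge1}a_k3^{-k}$ with $a_k$ independent and uniformly distributed on $\{0,2\}$. Its Fourier transform at $q\in\mathbb Z$ is $\widehat\mu(q)=\int e^{2\pi i q x}\,d\mu(x)$. For a nonzero integer $q$, $\nu_3(q)=\max\{a\ge0: 3^a\mid q\}$. *)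

(* Defs.v *)
From HB Require Import structures.
From mathcomp Require Import all_boot all_order all_algebra finmap complex.
From mathcomp Require Import all_classical all_reals all_analysis.
Set Implicit Arguments.
Unset Strict Implicit.
Unset Printing Implicit Defensive.
Import Order.TTheory GRing.Theory Num.Theory.
Import numFieldNormedType.Exports.
Local Open Scope classical_set_scope.
Local Open Scope ring_scope.

(* Mutual independence: the product rule for every finite subfamily. *)
Definition independent_RVs (R : realType) (d : measure_display)
    (Omega : measurableType d) (P : probability Omega R)
    (X : nat -> {RV P >-> R}) : Prop :=
  forall (J : {fset nat}) (B : nat -> set R),
    (forall k, measurable (B k)) ->
    P (\bigcap_(k in [set` J]) (X k @^-1` B k)) =
    (\prod_(k <- J) P (X k @^-1` B k))%E.

(* Given total mass 1, the two values below leave no mass outside {0, 2}. *)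
Definition uniform_on_02 (R : realType) (d : measure_display)
    (Omega : measurableType d) (P : probability Omega R)
    (X : {RV P >-> R}) : Prop :=
  distribution P X [set 0] = (2^-1)%:E /\ distribution P X [set 2] = (2^-1)%:E.

(* mu is the law of a random variable S with S = sum_{k >= 1} a_k 3^{-k} almost
   surely.  The digits are indexed from 0: [a k] is the digit a_{k+1}. *)
Definition is_cantor_measure (R : realType)
    (mu : probability R R) : Prop :=
  exists (d : measure_display) (Omega : measurableType d)
    (P : probability Omega R) (a : nat -> {RV P >-> R}) (S : {RV P >-> R}),
    [/\ independent_RVs a,
        forall k, uniform_on_02 (a k),
        {ae P, forall w, series (fun k => a k w / 3 ^+ k.+1) @ \oo --> S w} &
        forall B : set R, measurable B -> mu B = distribution P S B].

(* e^{it} for real t. *)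
Definition expi (R : realType) (t : R) : R[i] := Complex (cos t) (sin t).

(* Componentwise integral; the default value of [Rintegral] is harmless for the
   bounded measurable integrands used here. *)
Definition cRintegral (R : realType) (mu : probability R R)
    (f : R -> R[i]) : R[i] :=
  Complex (\int[mu]_x complex.Re (f x)) (\int[mu]_x complex.Im (f x)).

Definition fourier (R : realType) (mu : probability R R)
    (q : int) : R[i] :=
  cRintegral mu (fun x : R => expi (2 * pi * q%:~R * x)).

(* The 3-adic valuation of q <> 0 (0 at q = 0). *)
Definition nu3 (q : int) : nat := logn 3 `|q|%N.

(* Main.v *)
Require Import Defs.
From mathcomp Require Import all_boot all_order all_algebra finmap complex.
From mathcomp Require Import all_classical all_reals all_analysis.
From mathcomp Require Import measurable_realfun ring lra zify.
Set Implicit Arguments.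
Unset Strict Implicit.
Unset Printing Implicit Defensive.
Import Order.TTheory GRing.Theory Num.Theory.
Import numFieldNormedType.Exports.
Local Open Scope ring_scope.

(* The digits give |mu^(q)| = prod_{j>=1} |cos(2 pi q / 3^j)|, of which only
   finitely many factors are kept.  If 3 does not divide x, the j-th factor at
   x 2^n is periodic in n with period 2 * 3^(j-1), because
   4^(3^m) = 1 + 3^(m+1) u with u prime to 3.  Splitting a block of 2 * 3^J
   exponents n into three translates of a block of length 2 * 3^(J-1) changes
   only the last factor, whose argument moves by the three multiples of 2 pi/3;
   three cosines at such angles sum to zero, so their absolute values add up to
   at most 2.  Hence a block of length 2 * 3^J contributes at most 2^(J+1).
   For v = nu_3(q) < K, take J + 1 = K - v and cover the H exponents by 5 * 3^v
   blocks; since 3^gamma = 2 and 3^beta = 3/2, the total 5 * 2^(K-v) * 3^v is the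
   claimed bound with constant 5. *)

(** * Trigonometry: cosines at angles spaced by a third of a turn *)

Lemma cosD2piz (R : realType) (t : R) (z : int) :
  cos (t + 2 * pi * z%:~R) = cos t.
Proof.
have cosn s n : cos (s + 2 * pi * n%:R) = cos s :> R.
  elim: n => [|n IH]; first by rewrite mulr0 addr0.
  rewrite -IH -[RHS]cosD2pi; congr cos; rewrite -natr1 -mulr_natr; ring.
case: (intP z) => [|n|n]; first by rewrite mulr0 addr0.
  exact: cosn.
by rewrite -[LHS](cosn _ n.+1) mulrNz pmulrn; congr cos; ring.
Qed.

(** With c = cos(2 pi/3), tripling the angle gives 4c^3 - 3c - 1 = (c - 1)(2c + 1)^2 = 0, and
    injectivity of cos on [0, pi] excludes c = 1. *)
Lemma cos_2pi3 (R : realType) : cos (2 * pi / 3) = - 2^-1 :> R.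
Proof.
have pi0 := pi_gt0 R.
set a : R := 2 * pi / 3.
have c1 : cos (a + a + a) = 1.
  by rewrite -(cos2pi R); congr cos; rewrite /a -mulr_natr; field.
have cs := cos2Dsin2 a.
have ca : cos a != 1.
  apply/eqP => ca1; have /eqP : a = 0.
    by apply: cos_inj; rewrite ?in_itv /= ?ca1 ?cos0 //;
       apply/andP; split; rewrite /a; lra.
  by apply/negP/eqP; rewrite /a; lra.
rewrite !cosD !sinD in c1.
have : (cos a - 1) * (2 * cos a + 1) ^+ 2 = 0.
  have -> : (cos a - 1) * (2 * cos a + 1) ^+ 2 =
    (cos a * cos a - sin a * sin a) * cos a
    - (sin a * cos a + cos a * sin a) * sin a - 1
    + 3 * cos a * (cos a ^+ 2 + sin a ^+ 2 - 1) by ring.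
  by rewrite c1 cs; ring.
move/eqP; rewrite mulf_eq0 subr_eq0 (negbTE ca) /= expf_eq0 /= => /eqP ?; lra.
Qed.

(** Zero sum forces the largest absolute value to equal the sum of the other two, so the total is
    twice the largest. *)
Lemma sum_abs_le2 (R : realDomainType) (u v w : R) :
  `|u| <= 1 -> `|v| <= 1 -> `|w| <= 1 -> u + v + w = 0 ->
  `|u| + `|v| + `|w| <= 2.
Proof.
move=> + + + e; have -> : w = - u - v by lra.
rewrite !ler_norml => *.
by case: (ger0P u); case: (ger0P v); case: (ger0P (- u - v)); lra.
Qed.

Lemma norm_cos_le1 (R : realType) (t : R) : `|cos t| <= 1.
Proof. by rewrite ler_norml cos_geN1 cos_le1. Qed.

Lemma norm_sin_le1 (R : realType) (t : R) : `|sin t| <= 1.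
Proof. by rewrite ler_norml sin_geN1 sin_le1. Qed.

Lemma sum_cos_third (R : realType) (t : R) (b : int) : ~~ (3 %| b)%Z ->
  cos t + cos (t + 2 * pi * b%:~R / 3) + cos (t + 2 * pi * (2 * b)%:~R / 3) = 0.
Proof.
move=> b3; set a : R := 2 * pi / 3.
have sc : cos t + cos (t + a) + cos (t + (a + a)) = 0.
  have ca : cos a = - 2^-1 by exact: cos_2pi3.
  have sa : sin a ^+ 2 = 1 - cos a ^+ 2 by rewrite -(cos2Dsin2 a); ring.
  rewrite !cosD !sinD.
  transitivity (cos t * (1 + cos a + cos a ^+ 2 - sin a ^+ 2)
                - sin t * sin a * (1 + 2 * cos a)).
    by ring.
  by rewrite sa ca; field.
have shift (z : int) (r : int) : (exists k, z = r + 3 * k) ->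
    cos (t + 2 * pi * z%:~R / 3) = cos (t + 2 * pi * r%:~R / 3) :> R.
  case=> k ->; rewrite -[RHS](cosD2piz _ k); congr cos.
  by rewrite rmorphD rmorphM /=; field.
have e1 : t + 2 * pi * 1%:~R / 3 = t + a by rewrite /a mulr1.
have e2 : t + 2 * pi * 2%:~R / 3 = t + (a + a) by rewrite /a; field.
(* Modulo 3 the pair (b, 2b) is (1, 2) or (2, 1), so by [shift] both cases reduce to [sc]. *)
have : (exists k, b = 1 + 3 * k) \/ (exists k, b = 2 + 3 * k).
  have := divz_eq b 3.
  have : (0 <= b %% 3)%Z by exact: modz_ge0.
  have : (b %% 3 < 3)%Z by exact: ltz_pmod.
  have : (b %% 3)%Z != 0 by apply: contra b3 => /eqP/dvdz_mod0P.
  move=> r0 r3 r1 e.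
  have [r'|r'] : (b %% 3)%Z = 1 \/ (b %% 3)%Z = 2 by lia.
    by left; exists (b %/ 3)%Z; lia.
  by right; exists (b %/ 3)%Z; lia.
case=> -[k bk].
  rewrite (shift b 1); last by exists k.
  rewrite (shift (2 * b) 2); last by exists (2 * k); lia.
  by rewrite e1 e2.
rewrite (shift b 2); last by exists k.
rewrite (shift (2 * b) 1); last by exists (2 * k + 1); lia.
by rewrite e1 e2 -[RHS]sc; ring.
Qed.

(** * Powers of 2 modulo powers of 3 *)

Lemma pow4_pow3 (m : nat) :
  exists2 u : nat, ~~ (3 %| u)%N & (4 ^ 3 ^ m = 1 + 3 ^ m.+1 * u)%N.
Proof.
elim: m => [|m [u u3 IH]]; first by exists 1%N.
(* Expanding (1 + 3^(m+1) u)^3 and factoring 3^(m+2) out of the nonconstant terms gives this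
   witness, congruent to u modulo 3. *)
exists (u + 3 * (3 ^ m * u ^ 2 + 3 ^ m * 3 ^ m * u ^ 3))%N.
  by rewrite dvdn_addl ?dvdn_mulr.
rewrite expnSr expnM IH !(expnS 3); ring.
Qed.

Lemma pow2_period (J : nat) :
  exists2 u : nat, ~~ (3 %| u)%N & 2 ^+ (2 * 3 ^ J) = 1 + 3 ^+ J.+1 * u%:Z :> int.
Proof.
have [u u3 e] := pow4_pow3 J; exists u => //.
by rewrite exprM; move/(congr1 Posz): e; rewrite PoszD PoszM -!natz !natrX.
Qed.

(** * Cosine factors and their products summed over blocks of exponents *)

Definition cos_third (R : realType) (x : int) (j : nat) : R :=
  `|cos (2 * pi * x%:~R / 3 ^+ j)|.

Lemma cos_third_ge0 (R : realType) (x : int) (j : nat) : 0 <= cos_third R x j.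
Proof. exact: normr_ge0. Qed.

Lemma cos_third_le1 (R : realType) (x : int) (j : nat) : cos_third R x j <= 1.
Proof. exact: norm_cos_le1. Qed.

Lemma cos_third_scale (R : realType) (x : int) (v j : nat) :
  cos_third R (3 ^+ v * x) (v + j) = cos_third R x j.
Proof.
rewrite /cos_third; congr `|cos _|; rewrite rmorphM rmorphXn /= exprD.
have h k : 3 ^+ k != 0 :> R by rewrite expf_neq0.
by field; rewrite !h.
Qed.

Lemma cos_third_mod (R : realType) (x y : int) (j : nat) :
  (3 ^+ j %| y - x)%Z -> cos_third R y j = cos_third R x j.
Proof.
move=> /dvdzP[k e]; have -> : y = x + k * 3 ^+ j by rewrite -e; ring.
rewrite /cos_third -[in RHS](cosD2piz _ k); congr `|cos _|.
rewrite rmorphD rmorphM rmorphXn /=.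
have h : 3 ^+ j != 0 :> R by rewrite expf_neq0.
by field; rewrite h.
Qed.

Lemma cos_third_periodic (R : realType) (x : int) (n j J : nat) : (j <= J.+1)%N ->
  cos_third R (x * 2 ^+ (n + 2 * 3 ^ J)) j = cos_third R (x * 2 ^+ n) j.
Proof.
move=> jJ; apply: cos_third_mod.
have [u _ e] := pow2_period J.
have -> : x * 2 ^+ (n + 2 * 3 ^ J) - x * 2 ^+ n =
          x * 2 ^+ n * u%:Z * 3 ^+ J.+1 :> int.
  by rewrite exprD e; ring.
by apply: dvdz_mull; apply: dvdz_exp2l.
Qed.

Lemma sum_cos_third_le2 (R : realType) (x : int) (n J : nat) : ~~ (3 %| x)%Z ->
  cos_third R (x * 2 ^+ n) J.+2 + cos_third R (x * 2 ^+ (n + 2 * 3 ^ J)) J.+2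
   + cos_third R (x * 2 ^+ (n + 2 * 3 ^ J + 2 * 3 ^ J)) J.+2 <= 2.
Proof.
move=> x3; have [u u3 e2] := pow2_period J.
set y : int := x * 2 ^+ n.
have p3 : prime 3 by [].
have y3 : ~~ (3 %| y * u%:Z)%Z.
  rewrite /y !dvdzE !abszM abszX !Euclid_dvdM // Euclid_dvdX //= (negbTE u3).
  by rewrite !orbF -(dvdzE 3 x).
have h k : 3 ^+ k != 0 :> R by rewrite expf_neq0.
have -> : x * 2 ^+ (n + 2 * 3 ^ J) = y + 3 ^+ J.+1 * (y * u%:Z).
  transitivity (y * 2 ^+ (2 * 3 ^ J)); first by rewrite exprD mulrA.
  by rewrite [X in y * X]e2; ring.
(* The second translate is y (1 + 3^(J+1) u)^2; its term 3^(2J+2) y u^2 is a multiple of 3^(J+2),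
   hence invisible to this factor. *)
have -> : cos_third R (x * 2 ^+ (n + 2 * 3 ^ J + 2 * 3 ^ J)) J.+2 =
          cos_third R (y + 3 ^+ J.+1 * (2 * (y * u%:Z))) J.+2.
  apply: cos_third_mod; apply/dvdzP; exists (3 ^+ J * (y * u%:Z * u%:Z)).
  transitivity (y * 2 ^+ (2 * 3 ^ J) * 2 ^+ (2 * 3 ^ J)
                - (y + 3 ^+ J.+1 * (2 * (y * u%:Z)))).
    by rewrite !exprD !(mulrA x).
  by move: e2 => ->; rewrite !exprS; ring.
apply: sum_abs_le2; rewrite ?norm_cos_le1 //.
(* After division by 3^(J+2) the arguments are shifted by 2 pi b/3 and 4 pi b/3, with b = y u prime
   to 3. *)
rewrite -[RHS](sum_cos_third (2 * pi * y%:~R / 3 ^+ J.+2) y3).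
by congr (_ + cos _ + cos _);
   rewrite !(rmorphD, rmorphM, rmorphXn) /= !exprS; field; rewrite h.
Qed.

Lemma big_ord_triple (V : nmodType) (L : nat) (F : nat -> V) :
  \sum_(n < L + (L + L)) F n =
  \sum_(n < L) (F n + (F (L + n)%N + F (L + (L + n))%N)).
Proof. by rewrite !big_split_ord /= -!big_split. Qed.

Lemma sum_block (R : realType) (x : int) (M J : nat) : ~~ (3 %| x)%Z ->
  \sum_(n < 2 * 3 ^ J) \prod_(j < J.+1) cos_third R (x * 2 ^+ (M + n)) j.+1
    <= 2 ^+ J.+1.
Proof.
move=> x3; elim: J => [|J IH].
  rewrite muln1 expr1 !big_ord_recl !big_ord0 !mulr1 addr0.
  by rewrite (_ : 2 = 1 + 1) // lerD // cos_third_le1.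
rewrite (_ : 2 * 3 ^ J.+1 = 2 * 3 ^ J + (2 * 3 ^ J + 2 * 3 ^ J))%N; last first.
  by rewrite expnS; ring.
rewrite (big_ord_triple _
  (fun n => \prod_(j < J.+2) cos_third R (x * 2 ^+ (M + n)) j.+1)) exprSr.
apply: le_trans (ler_wpM2r _ IH) => //.
rewrite mulr_suml; apply: ler_sum => n _.
set p := \prod_(j < J.+1) _.
have pE m : \prod_(j < J.+2) cos_third R (x * 2 ^+ m) j.+1 =
  (\prod_(j < J.+1) cos_third R (x * 2 ^+ m) j.+1) * cos_third R (x * 2 ^+ m) J.+2.
  by rewrite big_ord_recr.
have per m : \prod_(j < J.+1) cos_third R (x * 2 ^+ (m + 2 * 3 ^ J)) j.+1 =
    \prod_(j < J.+1) cos_third R (x * 2 ^+ m) j.+1.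
  by apply: eq_bigr => j _; apply: cos_third_periodic; rewrite ltn_ord.
rewrite !pE (_ : M + (2 * 3 ^ J + n) = M + n + 2 * 3 ^ J)%N; last by ring.
rewrite (_ : M + (2 * 3 ^ J + (2 * 3 ^ J + n)) =
             M + n + 2 * 3 ^ J + 2 * 3 ^ J)%N; last by ring.
(* The common product [p] comes out of the three translates; the last factors add up to at most 2,
   which doubles the bound. *)
rewrite !per -/p -!mulrDr addrA ler_wpM2l ?sum_cos_third_le2 //.
by apply: prodr_ge0 => j _; exact: cos_third_ge0.
Qed.

Lemma sum_blocks (R : realType) (x : int) (M J B : nat) : ~~ (3 %| x)%Z ->
  \sum_(n < B * (2 * 3 ^ J)) \prod_(j < J.+1) cos_third R (x * 2 ^+ (M + n)) j.+1
    <= B%:R * 2 ^+ J.+1.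
Proof.
move=> x3; elim: B M => [|B IH] M; first by rewrite big_ord0 mul0r.
rewrite mulSn big_split_ord /= -(natr1 B) mulrDl mul1r addrC lerD ?sum_block //.
by under eq_bigr do rewrite addnA; exact: IH.
Qed.

Lemma sum_prod_cos (R : realType) (H K M : nat) (q : int) : q != 0 ->
    (H < 3 ^ K.+1)%N ->
  \sum_(n < H) \prod_(j < K) cos_third R (q * 2 ^+ (M + n)) j.+1
    <= 5 * 2 ^+ (K - minn (logn 3 `|q|) K) * 3 ^+ minn (logn 3 `|q|) K.
Proof.
move=> q0 HK; set v := minn _ _.
have c01 x j : 0 <= cos_third R x j <= 1 by rewrite cos_third_ge0 cos_third_le1.
(* If 3^K divides q, bounding every factor by 1 is enough: the sum is at most H < 3^(K+1) = 3 *
   3^K. *)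
have [Kv|vK] := leqP K (logn 3 `|q|).
  have -> : v = K by apply/minn_idPr.
  rewrite subnn mulr1; apply: (@le_trans _ _ H%:R).
    rewrite -[X in _ <= X%:R]card_ord -sumr_const; apply: ler_sum => n _.
    exact: prodr_ile1.
  apply: (@le_trans _ _ (3 ^ K.+1)%:R); first by rewrite ler_nat ltnW.
  rewrite natrX exprS ler_wpM2r ?exprn_ge0 //; lra.
have vE : v = logn 3 `|q| by apply/minn_idPl/ltnW.
rewrite -vE in vK.
have [x x3 qE] : exists2 x : int, ~~ (3 %| x)%Z & q = 3 ^+ v * x.
  have q0' : (0 < `|q|)%N by rewrite absz_gt0.
  have [m m3 qm] := pfactor_coprime (isT : prime 3) q0'.
  exists (sgz q * m%:Z).
    have -> : (3 %| sgz q * m%:Z)%Z = (3 %| m)%N.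
      by rewrite dvdzE abszM; case: sgzP q0 => //= _ _; rewrite mul1n.
    by rewrite -prime_coprime.
  have := congr1 Posz qm; rewrite -vE PoszM => e.
  rewrite [q in LHS]intEsg e -!natz natrX !natz; ring.
set J := (K - v).-1; have KE : K = (v + J.+1)%N by rewrite /J; lia.
have -> : (K - v = J.+1)%N by lia.
(* The first v factors are bounded by 1; in the J + 1 others the power 3^v cancels, leaving the
   factors of x = q / 3^v. *)
have step n : \prod_(j < K) cos_third R (q * 2 ^+ n) j.+1 <=
              \prod_(j < J.+1) cos_third R (x * 2 ^+ n) j.+1.
  rewrite KE big_split_ord /=.
  rewrite -[leRHS]mul1r; apply: ler_pM.
  - by apply: prodr_ge0 => *; exact: cos_third_ge0.
  - by apply: prodr_ge0 => *; exact: cos_third_ge0.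
  - exact: prodr_ile1.
  - apply: ler_prod => j _.
    by rewrite cos_third_ge0 qE -mulrA -addnS cos_third_scale lexx.
pose F n := \prod_(j < J.+1) cos_third R (x * 2 ^+ (M + n)) j.+1.
apply: (@le_trans _ _ (\sum_(n < H) F n)); first exact: ler_sum.
(* Origin of the constant 5: 3^(K+1) = 9 * 3^(v+J), while 5 * 3^v blocks cover 10 * 3^(v+J)
   exponents. *)
have HB : (H <= (5 * 3 ^ v) * (2 * 3 ^ J))%N.
  apply: leq_trans (ltnW HK) _.
  by rewrite KE -!addnS expnD !expnS; nia.
apply: (@le_trans _ _ (\sum_(n < (5 * 3 ^ v) * (2 * 3 ^ J)) F n)).
  rewrite (big_ord_widen _ F HB) big_mkcond.
  apply: ler_sum => n _; case: ifP => // _.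
  by apply: prodr_ge0 => *; exact: cos_third_ge0.
apply: le_trans (sum_blocks _ _ _ _ x3) _.
by rewrite natrM natrX mulrAC.
Qed.

(** * Passage to real exponents *)

(** As 3^gamma = 2, the left side is (3^K)^gamma (3/2)^v; monotonicity in the base replaces 3^K by
    H, and 3/2 = 3^(1 - gamma). *)
Lemma powR_bound (R : realType) (H K v : nat) : (3 ^ K <= H)%N -> (v <= K)%N ->
  2 ^+ (K - v) * 3 ^+ v <=
    H%:R `^ (ln 2 / ln 3) * 3 `^ ((1 - ln 2 / ln 3) * v%:R) :> R.
Proof.
move=> KH vK; set gamma : R := ln 2 / ln 3.
have l2 : 0 < ln (2 : R) by apply: ln_gt0; lra.
have l3 : 0 < ln (3 : R) by apply: ln_gt0; lra.
have g0 : 0 <= gamma by rewrite divr_ge0 // ltW.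
have e3 : 3 `^ gamma = 2 :> R.
  by rewrite /powR ifF ?divfK ?gt_eqF // lnK // posrE.
have b3 : 3 `^ (1 - gamma) = 3 / 2 :> R.
  have h : (1 == gamma) ==> (3 != 0 :> R) by apply/implyP => _; lra.
  by rewrite (powRB h) powRr1 // e3.
have Hg : 2 ^+ K <= H%:R `^ gamma :> R.
  rewrite -e3 -powR_mulrn ?powR_ge0 // -powRrM mulrC powRrM powR_mulrn //.
  by rewrite ge0_ler_powR // ?nnegrE ?exprn_ge0 // -natrX ler_nat.
rewrite (powRrM 3) b3 powR_mulrn; last by lra.
apply: le_trans (ler_wpM2r _ Hg); last by rewrite exprn_ge0 //; lra.
rewrite exprMn exprVn -[in leRHS](subnK vK) exprD.
have h : 2 ^+ v != 0 :> R by rewrite expf_neq0.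
rewrite le_eqVlt; apply/orP; left; apply/eqP; field; by rewrite h.
Qed.

(** * The law of the partial digit sums *)

Local Open Scope classical_set_scope.

(** Boolean codes make the digit strings of length m a finite type, over which a product of sums can
    be expanded. *)
Definition digit (R : realType) (b : bool) : R := if b then 2 else 0.

Definition digit_sum (R : realType) (m : nat) (e : {ffun 'I_m -> bool}) : R :=
  \sum_(k < m) digit R (e k) / 3 ^+ k.+1.

Section finite_law.
Context (R : realType) (d : measure_display) (Omega : measurableType d)
  (P : probability Omega R) (a : nat -> {RV P >-> R}).
Hypotheses (ind : independent_RVs a) (unif : forall k, uniform_on_02 (a k)).

(** The two level sets are disjoint, of probability 1/2 each, so together they have full measure. *)
Lemma ae_digit (k : nat) : {ae P, forall w, a k w = 0 \/ a k w = 2}.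
Proof.
have [u0 u2] := unif k.
have m02 (c : R) : measurable (a k @^-1` [set c]).
  rewrite -[_ @^-1` _]setTI; apply: measurable_funP => //;
    exact: measurable_set1.
exists (~` (a k @^-1` [set 0] `|` a k @^-1` [set 2])); split.
- by apply: measurableC; apply: measurableU.
- rewrite probability_setC; last exact: measurableU.
  suff -> : P (a k @^-1` [set 0] `|` a k @^-1` [set 2]) = 1%E by rewrite subee.
  rewrite measureU //.
    have -> : 1%E = ((2^-1)%:E + (2^-1)%:E)%E :> \bar R.
      by rewrite -EFinD; congr EFin; field.
    by congr (_ + _)%E; [exact: u0|exact: u2].
  by apply/seteqP; split => // w /= [-> /eqP]; rewrite eq_sym pnatr_eq0.
- by move=> w /= nw H; exact: nw.
Qed.

Definition cylinder (m : nat) (e : {ffun 'I_m -> bool}) : set Omega :=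
  [set w | forall k : 'I_m, a k w = digit R (e k)].

Lemma measurable_cylinder_proba (m : nat) (e : {ffun 'I_m -> bool}) :
  measurable (cylinder e) /\ P (cylinder e) = (2^-1 ^+ m)%:E.
Proof.
pose J := seq_fset tt (iota 0 m).
(* Independence takes a target set for every natural index; from m on the code defaults to [false],
   while the intersection ranges over k < m. *)
pose B (k : nat) : set R := [set digit R (odflt false (omap e (insub k)))].
have mB k : measurable (B k) by exact: measurable_set1.
have cE : cylinder e = \bigcap_(k in [set` J]) (a k @^-1` B k).
  apply/seteqP; split => w /= H.
    move=> k /=; rewrite seq_fsetE mem_iota /= => km.
    by rewrite /B /= insubT; exact: (H (Ordinal km)).
  move=> k; have := H k; rewrite /= seq_fsetE mem_iota /= ltn_ord => /(_ isT).
  by rewrite /B /= valK.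
split.
  rewrite cE; apply: bigcap_measurableType => k _.
  by rewrite -[_ @^-1` _]setTI; apply: measurable_funP.
rewrite cE ind //.
have half k : P (a k @^-1` B k) = (2^-1)%:E.
  by rewrite /B /digit; case: ifP => _; case: (unif k).
rewrite (eq_bigr (fun=> (2^-1)%:E)) //.
rewrite prodEFin; congr EFin.
rewrite big_const_seq count_predT size_seq_fset undup_id ?iota_uniq // size_iota.
by rewrite iter_mulr mulr1.
Qed.

Let S (m : nat) (w : Omega) : R := series (fun k => a k w / 3 ^+ k.+1) m.

Lemma measurable_partial (m : nat) : measurable_fun setT (S m).
Proof.
rewrite /S /series; apply: measurable_sum => k.
by apply: measurable_funM.
Qed.

(** Almost every w lies in exactly one cylinder, where the partial sum is constant; the integrand is
    thus almost everywhere a simple function with 2^m pieces of mass 2^-m. *)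
Lemma Rintegral_partial_sum (f : R -> R) (m : nat) : measurable_fun setT f ->
  \int[P]_w f (S m w) =
  \sum_(e : {ffun 'I_m -> bool}) 2^-1 ^+ m * f (digit_sum R e).
Proof.
move=> mf.
have mc (e : {ffun 'I_m -> bool}) : measurable (cylinder e).
  by have [] := measurable_cylinder_proba e.
have ig (e : {ffun 'I_m -> bool}) : P.-integrable setT
   (fun w => (f (digit_sum R e))%:E * (\1_(cylinder e) w)%:E)%E.
  by apply: integrableZl => //; exact: integrable_indic.
rewrite /Rintegral.
rewrite (@ae_eq_integral _ _ _ P setT
  (fun w => \sum_(e : {ffun 'I_m -> bool})
     (f (digit_sum R e))%:E * (\1_(cylinder e) w)%:E)%E) //.
- rewrite integral_sum // -sum_fine => [|e _]; last exact: integrable_fin_num.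
  apply: eq_bigr => e _; rewrite integralZl //; last exact: integrable_indic.
  transitivity (fine ((f (digit_sum R e))%:E * (2^-1 ^+ m)%:E)%E); last first.
    by rewrite /= mulrC.
  congr (fine (_ * _)%E); rewrite integral_indic // setIT.
  exact: (measurable_cylinder_proba e).2.
- apply/measurable_EFinP; apply: measurableT_comp => //.
  exact: measurable_partial.
- by apply: emeasurable_sum => e; exact: (measurable_int _ (ig e)).
- have := ae_foralln ae_digit.
  apply: filterS => w aw _.
  pose e : {ffun 'I_m -> bool} := [ffun k => a (val k) w == 2].
  have we : cylinder e w.
    move=> k; rewrite ffunE /digit; case: eqP => // n2.
    by case: (aw (val k)).
  have Se : S m w = digit_sum R e.
    by rewrite /S /series /= big_mkord; apply: eq_bigr => k _; rewrite we.
  rewrite (bigD1 e) //= indicE mem_set // mule1 big1 ?adde0 ?Se // => e' ne.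
  rewrite indicE memNset ?mule0 // => we'.
  case/eqP: ne; apply/ffunP => k.
  have : digit R (e' k) = digit R (e k) by rewrite -we -we'.
  rewrite /digit; case: (e' k); case: (e k) => // /eqP.
    by rewrite pnatr_eq0.
  by rewrite eq_sym pnatr_eq0.
Qed.

(** Dominated convergence with the constant majorant 1; continuity of f transports the almost sure
    convergence. *)
Lemma cvg_Rintegral_partial_sum (f : R -> R) (T : {RV P >-> R}) :
  continuous f -> (forall x, `|f x| <= 1) ->
  {ae P, forall w, S ^~ w @ \oo --> T w} ->
  (fun m => \int[P]_w f (S m w)) @ \oo --> \int[P]_w f (T w).
Proof.
move=> cf f1 ST.
have mf : measurable_fun setT f by exact: continuous_measurable_fun.
have [] := @dominated_convergence _ _ _ P setT measurableT
   (fun m w => (f (S m w))%:E) (fun w => (f (T w))%:E) (cst 1%:E).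
- move=> m; apply/measurable_EFinP; apply: measurableT_comp => //.
  exact: measurable_partial.
- by apply/measurable_EFinP; apply: measurableT_comp.
- apply: filterS ST => w Sw _; apply: cvg_EFin; first exact: nearW.
  by apply: (cvg_comp _ _ Sw); exact: cf.
- exact: finite_measure_integrable_cst.
- by apply: aeW => w m _; rewrite lee_fin.
move=> ifT _ H.
have fin : (\int[P]_w (f (T w))%:E)%E \is a fin_num by exact: integrable_fin_num.
by apply: fine_cvg; rewrite fineK.
Qed.

End finite_law.

(** * Complex exponentials and the product formula *)

Lemma expiD (R : realType) (x y : R) : expi (x + y) = expi x * expi y.
Proof.
rewrite /expi cosD sinD; apply/eqP; rewrite eq_complex /=.
by apply/andP; split; apply/eqP; ring.
Qed.

(** This is 1 + e^(2ix) = 2 cos(x) e^(ix), verified on the sum of squares of the real and imaginary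
    parts. *)
Lemma normc_add1_expi (R : realType) (x : R) :
  ComplexField.Normc.normc (1 + expi (2 * x)) = 2 * `|cos x|.
Proof.
rewrite /expi (_ : 2 * x = x + x); last by ring.
rewrite /= cosD sinD.
have -> : (1 + (cos x * cos x - sin x * sin x)) ^+ 2
  + (0 + (sin x * cos x + cos x * sin x)) ^+ 2 = (2 * cos x) ^+ 2.
  have e : sin x ^+ 2 = 1 - cos x ^+ 2 by rewrite -(cos2Dsin2 x); ring.
  transitivity ((1 + cos x ^+ 2 - sin x ^+ 2) ^+ 2 + 4 * cos x ^+ 2 * sin x ^+ 2).
    by ring.
  by rewrite e; ring.
by rewrite sqrtr_sqr normrM ger0_norm.
Qed.

Lemma Re_sum (R : realType) (I : Type) (s : seq I) (F : I -> R[i]) :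
  complex.Re (\sum_(i <- s) F i) = \sum_(i <- s) complex.Re (F i).
Proof. by apply: (big_morph (@complex.Re R)) => // -[x1 y1] [x2 y2]. Qed.

Lemma Im_sum (R : realType) (I : Type) (s : seq I) (F : I -> R[i]) :
  complex.Im (\sum_(i <- s) F i) = \sum_(i <- s) complex.Im (F i).
Proof. by apply: (big_morph (@complex.Im R)) => // -[x1 y1] [x2 y2]. Qed.

Lemma normc_prod (R : realType) (I : Type) (s : seq I) (F : I -> R[i]) :
  ComplexField.Normc.normc (\prod_(i <- s) F i) =
  \prod_(i <- s) ComplexField.Normc.normc (F i).
Proof.
by apply: (big_morph (@ComplexField.Normc.normc R));
  [exact: ComplexField.Normc.normcM | exact: ComplexField.Normc.normc1].
Qed.

Lemma expi_sum (R : realType) (I : Type) (s : seq I) (F : I -> R) :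
  expi (\sum_(i <- s) F i) = \prod_(i <- s) expi (F i).
Proof. by apply: (big_morph (@expi R)); [exact: expiD|rewrite /expi cos0 sin0]. Qed.

(** The exponential sum over digit strings factors digit by digit into terms 1 + e^(2it/3^(k+1)),
    whose moduli 2|cos| absorb the weight 2^-m. Cosine and sine sums stay separate to match the
    componentwise integral. *)
Lemma normc_sum_digits (R : realType) (m : nat) (t : R) :
  Num.sqrt
   ((\sum_(e : {ffun 'I_m -> bool}) 2^-1 ^+ m * cos (t * digit_sum R e)) ^+ 2 +
    (\sum_(e : {ffun 'I_m -> bool}) 2^-1 ^+ m * sin (t * digit_sum R e)) ^+ 2)
  = \prod_(k < m) `|cos (t / 3 ^+ k.+1)|.
Proof.
pose z : R[i] := \sum_(e : {ffun 'I_m -> bool}) expi (t * digit_sum R e).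
have zE : z = \prod_(k < m) (1 + expi (2 * (t / 3 ^+ k.+1))).
  transitivity (\prod_(k < m) \sum_(b : bool) expi (t * (digit R b / 3 ^+ k.+1))).
    rewrite bigA_distr_bigA; apply: eq_bigr => e _.
    by rewrite /digit_sum mulr_sumr expi_sum.
  apply: eq_bigr => k _; rewrite big_bool [LHS]addrC /digit mul0r mulr0.
  congr (_ + expi _); last by ring.
  by rewrite /expi cos0 sin0.
rewrite -!mulr_sumr !exprMn -mulrDr sqrtrM ?sqr_ge0 // sqrtr_sqr.
rewrite ger0_norm ?exprn_ge0 ?invr_ge0 //.
have -> : Num.sqrt ((\sum_(e : {ffun 'I_m -> bool}) cos (t * digit_sum R e)) ^+ 2 +
    (\sum_(e : {ffun 'I_m -> bool}) sin (t * digit_sum R e)) ^+ 2) =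
   ComplexField.Normc.normc z.
  transitivity (Num.sqrt (complex.Re z ^+ 2 + complex.Im z ^+ 2)); last first.
    by case: z {zE}.
  by rewrite /z Re_sum Im_sum.
rewrite zE normc_prod.
under eq_bigr do rewrite normc_add1_expi.
by rewrite big_split /= prodr_const card_ord mulrA -exprMn mulVf ?expr1n ?mul1r.
Qed.

(** The modulus is the limit of the products of m factors. Each factor is at most 1, so for m >= N
    these products are bounded by that of the first N. *)
Lemma normc_fourier_le (R : realType) (mu : probability R R) (q : int) (N : nat) :
  is_cantor_measure mu ->
  ComplexField.Normc.normc (fourier mu q) <=
    \prod_(k < N) cos_third R q k.+1.
Proof.
move=> [d [T [P [a [S [ind unif cvgS law]]]]]].
set t : R := 2 * pi * q%:~R.
(* Transfer from [mu] to the probability space of the digits, where dominated convergence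
   applies. *)
have change (f : R -> R) : continuous f -> (forall x, `|f x| <= 1) ->
    \int[mu]_x f (t * x) = \int[P]_w f (t * S w).
  move=> cf f1; have mf : measurable_fun setT (fun x : R => f (t * x)).
    apply: measurableT_comp; first exact: continuous_measurable_fun.
    exact: measurable_funM.
  rewrite /Rintegral; congr fine.
  rewrite (@eq_measure_integral _ _ _ _ (distribution P S)); last first.
    by move=> A mA _; exact: law.
  rewrite integral_distribution //; first exact/measurable_EFinP.
  apply: (@measurable_bounded_integrable _ _ _ _ (fun w => f (t * S w))) => //.
  - by rewrite (le_lt_trans (probability_le1 _ _)) ?ltry.
  - exact: measurableT_comp mf _.
  - by exists 1; split => // M M1 w _; exact: le_trans (f1 _) (ltW M1).
have lim (f : R -> R) : continuous f -> (forall x, `|f x| <= 1) ->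
   (fun m => \sum_(e : {ffun 'I_m -> bool}) 2^-1 ^+ m * f (t * digit_sum R e)) @ \oo
     --> \int[mu]_x f (t * x).
  move=> cf f1; rewrite change //.
  have cft : continuous (fun x => f (t * x)).
    by move=> x; apply: continuous_comp; [exact: mulrl_continuous|exact: cf].
  have mft := continuous_measurable_fun cft.
  suff <- : (fun m => \int[P]_w f (t * series (fun k => a k w / 3 ^+ k.+1) m)) =
    (fun m => \sum_(e : {ffun 'I_m -> bool}) 2^-1 ^+ m * f (t * digit_sum R e)).
    exact: (cvg_Rintegral_partial_sum cft (fun x => f1 _) cvgS).
  by apply/funext => m; exact: (Rintegral_partial_sum ind unif m mft).
have lc := lim cos (@continuous_cos R) (@norm_cos_le1 R).
have ls := lim sin (@continuous_sin R) (@norm_sin_le1 R).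
have lz : (fun m => \prod_(k < m) `|cos (t / 3 ^+ k.+1)|) @ \oo -->
    ComplexField.Normc.normc (fourier mu q).
  (* Written as square roots of sums of two squares, the products converge because the cosine and
     sine sums do. *)
  under eq_fun do rewrite -normc_sum_digits.
  by apply: cvg_comp; [exact: cvgD (cvgM lc lc) (cvgM ls ls)|exact: sqrt_continuous].
apply: (ler_cvg_to lz (cvg_cst _)).
exists N => // m /= Nm.
rewrite -(subnKC Nm) big_split_ord /=.
rewrite ler_piMr ?prodr_ge0 // prodr_ile1 // => k _.
by rewrite normr_ge0 norm_cos_le1.
Qed.

Local Close Scope classical_set_scope.

Theorem lemma7 (R : realType) :
  let gamma : R := ln 2 / ln 3 in
  let beta : R := 1 - gamma in
  exists A0 : R, 0 < A0 /\
    forall mu : probability R R, is_cantor_measure mu ->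
    forall H K : nat, (3 <= H)%N -> (3 ^ K <= H < 3 ^ K.+1)%N ->
    forall (M : nat) (q : int), q != 0 ->
      \sum_(M.+1 <= n < (M + H).+1)
          ComplexField.Normc.normc (fourier mu (q * 2 ^+ n))
        <= A0 * H%:R `^ gamma * 3 `^ (beta * (minn (nu3 q) K)%:R).
Proof.
move=> gamma beta; exists 5; split=> // mu cmu H K _ /andP[KH HK] M q q0.
(* The range M < n <= M + H becomes n < H, with exponents starting at M + 1. *)
rewrite -[X in \sum_(X <= _ < _) _]add0n big_addn subSS addKn big_mkord.
(* Truncating at K factors keeps the period in the exponent at most 2 * 3^(K-1), which is less than
   H. *)
apply: (@le_trans _ _ (\sum_(n < H) \prod_(j < K)
    cos_third R (q * 2 ^+ (M.+1 + n)) j.+1)).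
  by apply: ler_sum => n _; rewrite addnC; exact: normc_fourier_le.
apply: le_trans (sum_prod_cos R M.+1 q0 HK) _.
rewrite -!mulrA ler_wpM2l //; exact: powR_bound KH (geq_minr _ _).
Qed.
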